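(* Let $E$ be an arbitrary graph and let $K$ be a field with involution. Suppose that $L_K(E)$, with the involution induced from $K$, is $^*$-regular. Then: (i) $L_K(E)$ is locally unit-regular. (ii) If $L_K(E)$ is a unital ring, then $L_K(E)$ is unit-regular.
   Context: Graphs: a (directed) graph $E=(E^0,E^1,r,s)$ consists of a set $E^0$ of vertices and a set $E^1$ of edges (no restriction on cardinalities) with maps $r,s:E^1\to E^0$ (range and source). A vertex is a sink if it emits no edges; it is an infinite emitter if $s^{-1}(v)$ is infinite. A path of length $n\ge 1$ is a sequence of edges $\mu=e_1\dots e_n$ with $r(e_i)=s(e_{i+1})$ for $i=1,\dots,n-1$; $s(\mu)=s(e_1)$, $r(\mu)=r(e_n)$. Vertices are regarded as paths of length $0$. Leavitt path algebra: $L_K(E)$ is the (associative, not necessarily unital) $K$-algebra generated by $E^0\cup E^1\cup\{e^*\mid e\in E^1\}$ with relations: (V) $vw=\delta_{v,w}v$ for $v,w\in E^0$; (P1) $s(e)e=er(e)=e$ for $e\in E^1$; (P2) $r(e)e^*=e^*s(e)=e^*$ for $e\in E^1$; (CK1) $e^*f=\delta_{e,f}r(e)$ for $e,f\in E^1$; (CK2) $v=\sum_{e\in s^{-1}(v)}ee^*$ for every $v\in E^0$ that is neither a sink nor an infinite emitter. For a path $\mu=e_1\dots e_n$, $\mu^*=e_n^*\dots e_1^*$, and $v^*=v$ for vertices; $L_K(E)$ is spanned over $K$ by the elements $pq^*$ with $p,q$ paths. It is a ring with local units (finite sums of distinct vertices). Involutions: an involution on a ring $R$ is an additive map $^*:R\to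 R$ with $(ab)^*=b^*a^*$ and $(a^* )^*=a$. Given an involution $\overline{\phantom{k}}$ on $K$, the induced involution on $L_K(E)$ is $\left(\sum_i k_ip_iq_i^*\right)^*=\sum_i\overline{k_i}\,q_ip_i^*$ for $k_i\in K$ and paths $p_i,q_i$. A projection is an element $p$ with $p^*=p=p^2$. A ring $R$ with involution (with local units) is $^*$-regular if every principal right ideal is generated by a projection, i.e. for every $a\in R$ there is a projection $p\in R$ with $aR=pR$. Unit-regularity: a ring $R$ with identity is unit-regular if for each $a\in R$ there is an invertible element $u$ with $aua=a$. A ring $R$ with local units is locally unit-regular if for each $a\in R$ there are an idempotent $v\in R$ and elements $u,u'\in vRv$ (local inverses) such that $uu'=v=u'u$, $va=av=a$ and $aua=a$. *)

(* Defs.v *)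
From HB Require Import structures.
From mathcomp Require Import all_boot all_order all_algebra generic_quotient.
From mathcomp Require Import boolp classical_sets cardinality.

Set Implicit Arguments.
Unset Strict Implicit.
Unset Printing Implicit Defensive.

Import GRing.Theory.
Local Open Scope classical_set_scope.
Local Open Scope ring_scope.
Local Open Scope quotient_scope.

Reserved Notation "x ** y" (at level 40, left associativity).

HB.mixin Record Zmodule_isNuRing R of GRing.Zmodule R := {
  numul : R -> R -> R;
  numulA : associative numul;
  numulDl : left_distributive numul +%R;
  numulDr : right_distributive numul +%R
}.

#[short(type="nuRingType")]
HB.structure Definition NuRing := {R of GRing.Zmodule R & Zmodule_isNuRing R}.

Notation "x ** y" := (numul x y) : ring_scope.

HB.mixin Record NuRing_Lmodule_isNuAlgebra (K : nzRingType) A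
    of GRing.Lmodule K A & NuRing A := {
  nuscaleAl : forall (k : K) (a b : A), k *: (a ** b) = (k *: a) ** b;
  nuscaleAr : forall (k : K) (a b : A), k *: (a ** b) = a ** (k *: b)
}.

#[short(type="nuAlgType")]
HB.structure Definition NuAlgebra (K : nzRingType) :=
  {A of GRing.Lmodule K A & NuRing A & NuRing_Lmodule_isNuAlgebra K A}.

(* The product is a parameter, so that this applies both to a field and to a
   ring without identity. *)
Definition is_involution (R : zmodType) (mul : R -> R -> R) (star : R -> R) :=
  [/\ {morph star : a b / a + b},
      forall a b, star (mul a b) = mul (star b) (star a) &
      involutive star].

Section RingProperties.
Variable R : nuRingType.

Definition is_idempotent (v : R) := v ** v = v.

Definition is_projection (star : R -> R) (p : R) := star p = p /\ p = p ** p.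

Definition principal_right_ideal (a : R) : set R := [set a ** x | x in setT].

Definition star_regular (star : R -> R) :=
  forall a : R, exists2 p : R, is_projection star p &
    principal_right_ideal a = principal_right_ideal p.

Definition is_identity (one : R) := forall a : R, one ** a = a /\ a ** one = a.

Definition is_invertible (one u : R) :=
  exists u' : R, u ** u' = one /\ u' ** u = one.

Definition unit_regular (one : R) :=
  forall a : R, exists2 u : R, is_invertible one u & a ** u ** a = a.

Definition corner (v : R) : set R := [set v ** x ** v | x in setT].

Definition locally_unit_regular :=
  forall a : R, exists v u u' : R,
    [/\ is_idempotent v, corner v u & corner v u'] /\
    [/\ u ** u' = v, u' ** u = v, v ** a = a, a ** v = a & a ** u ** a = a].

End RingProperties.

Record graph := Graph {
  vertex : Type;
  edge : Type;
  edge_source : edge -> vertex;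
  edge_range : edge -> vertex
}.

Section GraphNotions.
Variable E : graph.

Definition emitted (v : vertex E) : set (edge E) := [set e | edge_source e = v].
Definition is_sink (v : vertex E) := emitted v = set0.
Definition is_infinite_emitter (v : vertex E) := infinite_set (emitted v).

(* [es] lists the edges emitted by [v], without repetition. *)
Definition enumerates_emitted (v : vertex E) (es : seq {classic edge E}) :=
  uniq es /\ forall e : {classic edge E}, e \in es <-> emitted v e.

(* The pair [(v, es)] stands for the vertex [v] if [es] is empty, and for the
   path [es] starting at [v] otherwise. *)
Fixpoint is_path_from (v : vertex E) (es : seq (edge E)) : Prop :=
  if es is e :: es' then edge_source e = v /\ is_path_from (edge_range e) es' else True.

Record gpath := GPath {
  gpath_source : vertex E;
  gpath_edges : seq (edge E);
  gpathP : is_path_from gpath_source gpath_edges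
}.

End GraphNotions.

(* The Leavitt path algebra is the quotient of the formal K-algebra expressions
   in the generators by the least congruence containing the axioms of
   (associative, nonunital) K-algebras and the relations (V), (P1), (P2),
   (CK1), (CK2). *)
Section LeavittPathAlgebra.
Variables (K : fieldType) (E : graph).

Inductive lexpr :=
  | LVertex of vertex E
  | LEdge of edge E
  | LGhost of edge E
  | LZero
  | LAdd of lexpr & lexpr
  | LScale of K & lexpr
  | LMul of lexpr & lexpr.

Definition lexpr_sum (s : seq lexpr) : lexpr := foldr LAdd LZero s.

Inductive lequiv : lexpr -> lexpr -> Prop :=
  | lequiv_refl x : lequiv x x
  | lequiv_sym x y : lequiv x y -> lequiv y x
  | lequiv_trans y x z : lequiv x y -> lequiv y z -> lequiv x z
  | lequiv_add x x' y y' :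
      lequiv x x' -> lequiv y y' -> lequiv (LAdd x y) (LAdd x' y')
  | lequiv_scale k x x' : lequiv x x' -> lequiv (LScale k x) (LScale k x')
  | lequiv_mul x x' y y' :
      lequiv x x' -> lequiv y y' -> lequiv (LMul x y) (LMul x' y')
  | lequiv_addA x y z : lequiv (LAdd x (LAdd y z)) (LAdd (LAdd x y) z)
  | lequiv_addC x y : lequiv (LAdd x y) (LAdd y x)
  | lequiv_add0 x : lequiv (LAdd LZero x) x
  | lequiv_addN x : lequiv (LAdd (LScale (- 1) x) x) LZero
  | lequiv_scaleA k l x : lequiv (LScale k (LScale l x)) (LScale (k * l) x)
  | lequiv_scale1 x : lequiv (LScale 1 x) x
  | lequiv_scaleDr k x y :
      lequiv (LScale k (LAdd x y)) (LAdd (LScale k x) (LScale k y))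
  | lequiv_scaleDl k l x :
      lequiv (LScale (k + l) x) (LAdd (LScale k x) (LScale l x))
  | lequiv_mulA x y z : lequiv (LMul x (LMul y z)) (LMul (LMul x y) z)
  | lequiv_mulDl x y z : lequiv (LMul (LAdd x y) z)
      (LAdd (LMul x z) (LMul y z))
  | lequiv_mulDr x y z : lequiv (LMul x (LAdd y z))
      (LAdd (LMul x y) (LMul x z))
  | lequiv_scaleAl k x y : lequiv (LScale k (LMul x y)) (LMul (LScale k x) y)
  | lequiv_scaleAr k x y : lequiv (LScale k (LMul x y)) (LMul x (LScale k y))
  | lequiv_V v : lequiv (LMul (LVertex v) (LVertex v)) (LVertex v)
  | lequiv_V0 v w : v <> w -> lequiv (LMul (LVertex v) (LVertex w)) LZero
  | lequiv_P1s e : lequiv (LMul (LVertex (edge_source e)) (LEdge e)) (LEdge e)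
  | lequiv_P1r e : lequiv (LMul (LEdge e) (LVertex (edge_range e))) (LEdge e)
  | lequiv_P2r e : lequiv (LMul (LVertex (edge_range e)) (LGhost e)) (LGhost e)
  | lequiv_P2s e : lequiv (LMul (LGhost e) (LVertex (edge_source e))) (LGhost e)
  | lequiv_CK1 e : lequiv (LMul (LGhost e) (LEdge e)) (LVertex (edge_range e))
  | lequiv_CK10 e f : e <> f -> lequiv (LMul (LGhost e) (LEdge f)) LZero
  | lequiv_CK2 v es :
      ~ is_sink v -> ~ is_infinite_emitter v -> enumerates_emitted v es ->
      lequiv (LVertex v)
        (lexpr_sum [seq LMul (LEdge e) (LGhost e) | e : edge E <- es]).

HB.instance Definition _ := gen_eqMixin lexpr.
HB.instance Definition _ := gen_choiceMixin lexpr.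

Definition lequivb (x y : lexpr) : bool := `[< lequiv x y >].

Lemma lequivb_refl : reflexive lequivb.
Proof. by move=> x; apply/asboolP; apply: lequiv_refl. Qed.

Lemma lequivb_sym : symmetric lequivb.
Proof. by move=> x y; apply/idP/idP => /asboolP/lequiv_sym/asboolP. Qed.

Lemma lequivb_trans : transitive lequivb.
Proof.
by move=> y x z /asboolP xy /asboolP yz; apply/asboolP; apply: lequiv_trans yz.
Qed.

Canonical lequiv_rel := EquivRel lequivb lequivb_refl lequivb_sym lequivb_trans.

Definition lpa := {eq_quot lequiv_rel}.

HB.instance Definition _ : EqQuotient _ lequiv_rel lpa := EqQuotient.on lpa.
HB.instance Definition _ := Choice.on lpa.

Definition lpi (x : lexpr) : lpa := \pi_lpa x.

Lemma lpiP x y : lpi x = lpi y <-> lequiv x y.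
Proof.
split=> [/eqmodP/asboolP //|xy].
by apply/eqmodP; apply/asboolP.
Qed.

Lemma lpi_repr x : lpi (repr x) = x.
Proof. exact: reprK. Qed.

Lemma lequiv_repr x : lequiv (repr (lpi x)) x.
Proof. by apply/lpiP; rewrite lpi_repr. Qed.

Lemma lpa_ind (P : lpa -> Prop) : (forall x, P (lpi x)) -> forall x, P x.
Proof. by move=> Ppi x; rewrite -(lpi_repr x). Qed.

Definition lpa_zero : lpa := lpi LZero.
Definition lpa_add (x y : lpa) : lpa := lpi (LAdd (repr x) (repr y)).
Definition lpa_scale (k : K) (x : lpa) : lpa := lpi (LScale k (repr x)).
Definition lpa_opp (x : lpa) : lpa := lpa_scale (- 1) x.
Definition lpa_mul (x y : lpa) : lpa := lpi (LMul (repr x) (repr y)).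

Lemma lpi_addE x y : lpa_add (lpi x) (lpi y) = lpi (LAdd x y).
Proof. by apply/lpiP/lequiv_add; apply: lequiv_repr. Qed.

Lemma lpi_scaleE k x : lpa_scale k (lpi x) = lpi (LScale k x).
Proof. exact/lpiP/lequiv_scale/lequiv_repr. Qed.

Lemma lpi_mulE x y : lpa_mul (lpi x) (lpi y) = lpi (LMul x y).
Proof. by apply/lpiP/lequiv_mul; apply: lequiv_repr. Qed.

Let lpiE := (lpi_addE, lpi_scaleE, lpi_mulE).

Lemma lpa_addA : associative lpa_add.
Proof.
elim/lpa_ind=> x; elim/lpa_ind=> y; elim/lpa_ind=> z.
by rewrite !lpiE; apply/lpiP/lequiv_addA.
Qed.

Lemma lpa_addC : commutative lpa_add.
Proof.
by elim/lpa_ind=> x; elim/lpa_ind=> y; rewrite !lpiE; apply/lpiP/lequiv_addC.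
Qed.

Lemma lpa_add0 : left_id lpa_zero lpa_add.
Proof. by elim/lpa_ind=> x; rewrite !lpiE; apply/lpiP/lequiv_add0. Qed.

Lemma lpa_addN : left_inverse lpa_zero lpa_opp lpa_add.
Proof.
by elim/lpa_ind=> x; rewrite /lpa_opp !lpiE; apply/lpiP/lequiv_addN.
Qed.

HB.instance Definition _ :=
  GRing.isZmodule.Build lpa lpa_addA lpa_addC lpa_add0 lpa_addN.

Lemma lpa_scaleA k l x : lpa_scale k (lpa_scale l x) = lpa_scale (k * l) x.
Proof. by elim/lpa_ind: x=> x; rewrite !lpiE; apply/lpiP/lequiv_scaleA. Qed.

Lemma lpa_scale1 : left_id 1 lpa_scale.
Proof. by elim/lpa_ind=> x; rewrite !lpiE; apply/lpiP/lequiv_scale1. Qed.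

Lemma lpa_scaleDr : right_distributive lpa_scale +%R.
Proof.
move=> k; elim/lpa_ind=> x; elim/lpa_ind=> y.
by rewrite [X in lpa_scale _ X]lpi_addE !lpi_scaleE [RHS]lpi_addE; apply/lpiP/lequiv_scaleDr.
Qed.

Lemma lpa_scaleDl x : {morph lpa_scale^~ x : k l / k + l}.
Proof.
elim/lpa_ind: x => x k l.
by rewrite !lpi_scaleE [RHS]lpi_addE; apply/lpiP/lequiv_scaleDl.
Qed.

HB.instance Definition _ :=
  GRing.Zmodule_isLmodule.Build K lpa
    lpa_scaleA lpa_scale1 lpa_scaleDr lpa_scaleDl.

Lemma lpa_mulA : associative lpa_mul.
Proof.
elim/lpa_ind=> x; elim/lpa_ind=> y; elim/lpa_ind=> z.
by rewrite !lpi_mulE; apply/lpiP/lequiv_mulA.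
Qed.

Lemma lpa_mulDl : left_distributive lpa_mul +%R.
Proof.
elim/lpa_ind=> x; elim/lpa_ind=> y; elim/lpa_ind=> z.
by rewrite [X in lpa_mul X]lpi_addE !lpi_mulE [RHS]lpi_addE;
  apply/lpiP/lequiv_mulDl.
Qed.

Lemma lpa_mulDr : right_distributive lpa_mul +%R.
Proof.
elim/lpa_ind=> x; elim/lpa_ind=> y; elim/lpa_ind=> z.
by rewrite [X in lpa_mul _ X]lpi_addE !lpi_mulE [RHS]lpi_addE;
  apply/lpiP/lequiv_mulDr.
Qed.

HB.instance Definition _ :=
  Zmodule_isNuRing.Build lpa lpa_mulA lpa_mulDl lpa_mulDr.

Lemma lpa_scaleAl (k : K) (x y : lpa) : k *: (x ** y) = (k *: x) ** y.
Proof.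
elim/lpa_ind: x => x; elim/lpa_ind: y => y; rewrite /numul /= /GRing.scale /=.
by rewrite !lpiE; apply/lpiP/lequiv_scaleAl.
Qed.

Lemma lpa_scaleAr (k : K) (x y : lpa) : k *: (x ** y) = x ** (k *: y).
Proof.
elim/lpa_ind: x => x; elim/lpa_ind: y => y; rewrite /numul /= /GRing.scale /=.
by rewrite !lpiE; apply/lpiP/lequiv_scaleAr.
Qed.

HB.instance Definition _ :=
  NuRing_Lmodule_isNuAlgebra.Build K lpa lpa_scaleAl lpa_scaleAr.

Lemma lpi_zero : lpi LZero = 0.
Proof. by []. Qed.

Lemma lpi_add x y : lpi (LAdd x y) = lpi x + lpi y.
Proof. by rewrite [RHS]lpi_addE. Qed.

Lemma lpi_scale k x : lpi (LScale k x) = k *: lpi x.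
Proof. by rewrite [RHS]lpi_scaleE. Qed.

Lemma lpi_mul x y : lpi (LMul x y) = lpi x ** lpi y.
Proof. by rewrite [RHS]lpi_mulE. Qed.

Definition lpa_vertex (v : vertex E) : lpa := lpi (LVertex v).
Definition lpa_edge (e : edge E) : lpa := lpi (LEdge e).
Definition lpa_ghost (e : edge E) : lpa := lpi (LGhost e).

Record leavitt_family (A : nuAlgType K)
    (V : vertex E -> A) (X G : edge E -> A) : Prop := LeavittFamily {
  leavitt_V v : V v ** V v = V v;
  leavitt_V0 v w : v <> w -> V v ** V w = 0;
  leavitt_P1s e : V (edge_source e) ** X e = X e;
  leavitt_P1r e : X e ** V (edge_range e) = X e;
  leavitt_P2r e : V (edge_range e) ** G e = G e;
  leavitt_P2s e : G e ** V (edge_source e) = G e;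
  leavitt_CK1 e : G e ** X e = V (edge_range e);
  leavitt_CK10 e f : e <> f -> G e ** X f = 0;
  leavitt_CK2 v es :
    ~ is_sink v -> ~ is_infinite_emitter v -> enumerates_emitted v es ->
    V v = \sum_(e <- es) X e ** G e
}.

Lemma lpa_family :
  @leavitt_family (lpa : nuAlgType K) lpa_vertex lpa_edge lpa_ghost.
Proof.
split=> [v|v w vw|e|e|e|e|e|e f ef|v es sv iv ves].
- by rewrite -lpi_mul; apply/lpiP/lequiv_V.
- by rewrite -lpi_mul -lpi_zero; apply/lpiP/lequiv_V0.
- by rewrite -lpi_mul; apply/lpiP/lequiv_P1s.
- by rewrite -lpi_mul; apply/lpiP/lequiv_P1r.
- by rewrite -lpi_mul; apply/lpiP/lequiv_P2r.
- by rewrite -lpi_mul; apply/lpiP/lequiv_P2s.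
- by rewrite -lpi_mul; apply/lpiP/lequiv_CK1.
- by rewrite -lpi_mul -lpi_zero; apply/lpiP/lequiv_CK10.
have -> : lpa_vertex v =
    lpi (lexpr_sum [seq LMul (LEdge e) (LGhost e) | e : edge E <- es]).
  exact/lpiP/lequiv_CK2.
elim: es {ves} => [|e es IHes] /=; first by rewrite big_nil.
by rewrite big_cons lpi_add lpi_mul IHes.
Qed.

Lemma lpa_generators_ind (P : lpa -> Prop) :
    (forall v, P (lpa_vertex v)) -> (forall e, P (lpa_edge e)) ->
    (forall e, P (lpa_ghost e)) -> P 0 ->
    (forall x y, P x -> P y -> P (x + y)) ->
    (forall k x, P x -> P (k *: x)) ->
    (forall x y, P x -> P y -> P (x ** y)) ->
  forall x, P x.
Proof.
move=> PV PX PG P0 PD PZ PM; elim/lpa_ind.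
elim=> [v|e|e||x Px y Py|k x Px|x Px y Py].
- exact: PV.
- exact: PX.
- exact: PG.
- exact: P0.
- by rewrite lpi_add; apply: PD.
- by rewrite lpi_scale; apply: PZ.
- by rewrite lpi_mul; apply: PM.
Qed.

Section Universal.
Variables (A : nuAlgType K) (V : vertex E -> A) (X G : edge E -> A).
Hypothesis VXG : leavitt_family V X G.

Fixpoint leval (x : lexpr) : A :=
  match x with
  | LVertex v => V v
  | LEdge e => X e
  | LGhost e => G e
  | LZero => 0
  | LAdd x y => leval x + leval y
  | LScale k x => k *: leval x
  | LMul x y => leval x ** leval y
  end.

Lemma leval_lequiv x y : lequiv x y -> leval x = leval y.
Proof.
elim=> //= {x y}.
- by move=> y x z _ -> _.
- by move=> x x' y y' _ -> _ ->.
- by move=> k x x' _ ->.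
- by move=> x x' y y' _ -> _ ->.
- by move=> x y z; rewrite addrA.
- by move=> x y; rewrite addrC.
- by move=> x; rewrite add0r.
- by move=> x; rewrite scaleN1r addNr.
- by move=> k l x; rewrite scalerA.
- by move=> x; rewrite scale1r.
- by move=> k x y; rewrite scalerDr.
- by move=> k l x; rewrite scalerDl.
- by move=> x y z; rewrite numulA.
- by move=> x y z; rewrite numulDl.
- by move=> x y z; rewrite numulDr.
- by move=> k x y; rewrite nuscaleAl.
- by move=> k x y; rewrite nuscaleAr.
- exact: leavitt_V VXG.
- exact: leavitt_V0 VXG.
- exact: leavitt_P1s VXG.
- exact: leavitt_P1r VXG.
- exact: leavitt_P2r VXG.
- exact: leavitt_P2s VXG.
- exact: leavitt_CK1 VXG.
- exact: leavitt_CK10 VXG.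
- move=> v es sv iv ves; rewrite (leavitt_CK2 VXG sv iv ves).
  elim: es {ves} => [|e es IHes] /=; first by rewrite big_nil.
  by rewrite big_cons IHes.
Qed.

Definition lpa_lift (x : lpa) : A := leval (repr x).

Lemma lpa_liftE x : lpa_lift (lpi x) = leval x.
Proof. exact/leval_lequiv/lequiv_repr. Qed.

Lemma lpa_universal :
  [/\ linear lpa_lift, {morph lpa_lift : x y / x ** y},
      lpa_lift \o lpa_vertex =1 V, lpa_lift \o lpa_edge =1 X &
      lpa_lift \o lpa_ghost =1 G].
Proof.
split=> [k x y|x y|v|e|e]; last 3 first.
- by rewrite /= lpa_liftE.
- by rewrite /= lpa_liftE.
- by rewrite /= lpa_liftE.
- elim/lpa_ind: x => x; elim/lpa_ind: y => y.
  by rewrite -lpi_scale -lpi_add !lpa_liftE.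
- elim/lpa_ind: x => x; elim/lpa_ind: y => y.
  by rewrite -lpi_mul !lpa_liftE.
Qed.

Lemma lpa_universal_unique (f : lpa -> A) :
    linear f -> {morph f : x y / x ** y} ->
    f \o lpa_vertex =1 V -> f \o lpa_edge =1 X -> f \o lpa_ghost =1 G ->
  f =1 lpa_lift.
Proof.
have [gL gM gV gX gG] := lpa_universal.
move=> fL fM fV fX fG.
have lin0 (h : lpa -> A) : linear h -> h 0 = 0.
  move=> hL; have := hL (- 1) 0 0.
  by rewrite scaler0 addr0 scaleN1r addNr.
have linD (h : lpa -> A) x y : linear h -> h (x + y) = h x + h y.
  by move=> hL; rewrite -{1}(scale1r x) hL scale1r.
have linZ (h : lpa -> A) k x : linear h -> h (k *: x) = k *: h x.
  by move=> hL; rewrite -[k *: x]addr0 hL lin0 // addr0.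
elim/lpa_generators_ind=> [v|e|e||x y fx fy|k x fx|x y fx fy].
- exact: etrans (fV v) (esym (gV v)).
- exact: etrans (fX e) (esym (gX e)).
- exact: etrans (fG e) (esym (gG e)).
- by rewrite !lin0.
- by rewrite !linD // fx fy.
- by rewrite !linZ // fx.
- by rewrite fM gM fx fy.
Qed.

End Universal.

Section InducedInvolution.
Variable conj : K -> K.

Fixpoint lexpr_star (x : lexpr) : lexpr :=
  match x with
  | LVertex v => LVertex v
  | LEdge e => LGhost e
  | LGhost e => LEdge e
  | LZero => LZero
  | LAdd x y => LAdd (lexpr_star x) (lexpr_star y)
  | LScale k x => LScale (conj k) (lexpr_star x)
  | LMul x y => LMul (lexpr_star y) (lexpr_star x)
  end.

(* This is the induced involution when [conj] is an involution; see
   [lpa_starE]. *)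
Definition lpa_star (x : lpa) : lpa := lpi (lexpr_star (repr x)).

Hypothesis conjP : is_involution *%R conj.

Let conjD k l : conj (k + l) = conj k + conj l.
Proof. by case: conjP. Qed.

Let conjM k l : conj (k * l) = conj k * conj l.
Proof. by case: conjP => _ cM _; rewrite cM mulrC. Qed.

Let conjK : involutive conj.
Proof. by case: conjP. Qed.

Let conj1 : conj 1 = 1.
Proof. by rewrite -[LHS]mulr1 -{2}(conjK 1) -conjM mul1r conjK. Qed.

Let conjN1 : conj (- 1) = - 1.
Proof.
have conj0 : conj 0 = 0 by apply: (addrI (conj 0)); rewrite -conjD !addr0.
by apply/eqP; rewrite -addr_eq0 -{2}conj1 -conjD addNr conj0.
Qed.

Lemma lequiv_star x y : lequiv x y -> lequiv (lexpr_star x) (lexpr_star y).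
Proof.
elim=> /= {x y}.
- by move=> x; apply: lequiv_refl.
- by move=> x y _; apply: lequiv_sym.
- by move=> y x z _ + _; apply: lequiv_trans.
- by move=> x x' y y' _ xx' _; apply: lequiv_add.
- by move=> k x x' _; apply: lequiv_scale.
- by move=> x x' y y' _ xx' _ yy'; apply: lequiv_mul.
- by move=> x y z; apply: lequiv_addA.
- by move=> x y; apply: lequiv_addC.
- by move=> x; apply: lequiv_add0.
- by move=> x; rewrite conjN1; apply: lequiv_addN.
- by move=> k l x; rewrite conjM; apply: lequiv_scaleA.
- by move=> x; rewrite conj1; apply: lequiv_scale1.
- by move=> k x y; apply: lequiv_scaleDr.
- by move=> k l x; rewrite conjD; apply: lequiv_scaleDl.
- by move=> x y z; apply/lequiv_sym/lequiv_mulA.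
- by move=> x y z; apply: lequiv_mulDr.
- by move=> x y z; apply: lequiv_mulDl.
- by move=> k x y; apply: lequiv_scaleAr.
- by move=> k x y; apply: lequiv_scaleAl.
- exact: lequiv_V.
- by move=> v w vw; apply: lequiv_V0 => /esym.
- exact: lequiv_P2s.
- exact: lequiv_P2r.
- exact: lequiv_P1r.
- exact: lequiv_P1s.
- exact: lequiv_CK1.
- by move=> e f ef; apply: lequiv_CK10 => /esym.
- move=> v es sv iv ves.
  suff -> : lexpr_star
      (lexpr_sum [seq LMul (LEdge e) (LGhost e) | e : edge E <- es]) =
      lexpr_sum [seq LMul (LEdge e) (LGhost e) | e : edge E <- es].
    exact: lequiv_CK2.
  by elim: es {ves} => //= e es ->.
Qed.

Lemma lpi_star x : lpa_star (lpi x) = lpi (lexpr_star x).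
Proof. exact/lpiP/lequiv_star/lequiv_repr. Qed.

Lemma lpa_star_vertex v : lpa_star (lpa_vertex v) = lpa_vertex v.
Proof. exact: lpi_star. Qed.

Lemma lpa_star_edge e : lpa_star (lpa_edge e) = lpa_ghost e.
Proof. exact: lpi_star. Qed.

Lemma lpa_star_ghost e : lpa_star (lpa_ghost e) = lpa_edge e.
Proof. exact: lpi_star. Qed.

Lemma lpa_star0 : lpa_star 0 = 0.
Proof. by rewrite -lpi_zero lpi_star. Qed.

Lemma lpa_starZ k x : lpa_star (k *: x) = conj k *: lpa_star x.
Proof.
by elim/lpa_ind: x => x; rewrite -lpi_scale !lpi_star -lpi_scale.
Qed.

Lemma lpa_star_involution : is_involution (@numul lpa) lpa_star.
Proof.
split.
- elim/lpa_ind=> x; elim/lpa_ind=> y.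
  by rewrite -lpi_add !lpi_star -lpi_add.
- elim/lpa_ind=> x; elim/lpa_ind=> y.
  by rewrite -lpi_mul !lpi_star -lpi_mul.
- elim/lpa_ind=> x; rewrite !lpi_star; congr lpi.
  by elim: x => //= [x -> y ->|k x ->|x -> y ->] //; rewrite conjK.
Qed.

(* The start vertex is kept as an initial factor, which (P1) absorbs unless the
   path is a vertex. *)
Definition lpa_path (p : gpath E) : lpa :=
  foldl (fun x e => x ** lpa_edge e)
    (lpa_vertex (gpath_source p)) (gpath_edges p).

Definition lpa_gpath (p : gpath E) : lpa :=
  foldl (fun x e => lpa_ghost e ** x)
    (lpa_vertex (gpath_source p)) (gpath_edges p).

Lemma lpa_star_path p : lpa_star (lpa_path p) = lpa_gpath p.
Proof.
have [_ starM _] := lpa_star_involution.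
rewrite /lpa_path /lpa_gpath.
elim/last_ind: (gpath_edges p) => [|es e IHes]; first exact: lpa_star_vertex.
by rewrite !foldl_rcons starM lpa_star_edge IHes.
Qed.

Lemma lpa_starE (I : Type) (r : seq I) (k : I -> K) (p q : I -> gpath E) :
  lpa_star (\sum_(i <- r) k i *: (lpa_path (p i) ** lpa_gpath (q i))) =
  \sum_(i <- r) conj (k i) *: (lpa_path (q i) ** lpa_gpath (p i)).
Proof.
have [starD starM starK] := lpa_star_involution.
elim: r => [|i r IHr]; first by rewrite !big_nil lpa_star0.
rewrite !big_cons starD IHr lpa_starZ starM lpa_star_path.
by rewrite -lpa_star_path starK.
Qed.

End InducedInvolution.

End LeavittPathAlgebra.

(* Main.v *)
(* A *-regular ring with local units is von Neumann regular. If there were a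
   closed path c at v, then a = v - c would satisfy a x a = a for some x. Let
   L_K(E) act on functions on (infinite paths) x Z, edges raising the degree in
   Z by one. Evaluating at the periodic path c^oo, a becomes the operator 1 - T,
   with T the shift by the length of c. As 1 - T is injective on functions of
   bounded support, a x a = a makes the delta function at 0 a value of 1 - T on a
   function of bounded support, which is absurd. So E is acyclic.

   For finite sets F of edges and W of vertices, acyclicity leaves finitely many
   paths with edges in F and source in W. With w' = w - sum_f f f^* over the f in
   F emitted by w, the elements p w' q^* (p, q such paths ending at w) are matrix
   units, orthogonal for distinct w, and any given element of L_K(E) is a linear
   combination of them once F and W are large enough. Hence it lies in an image of
   a finite product of matrix algebras over K, which is unit-regular. In the
   unital case, u + (1 - v) is an invertible inner inverse. *)
Require Import Defs.
From HB Require Import structures.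
From mathcomp Require Import all_boot all_order all_algebra.
From mathcomp Require Import boolp zify ring.

Set Implicit Arguments.
Unset Strict Implicit.
Unset Printing Implicit Defensive.

Import Order.TTheory GRing.Theory Num.Theory.
Local Open Scope ring_scope.

(** * Rings without identity *)

Section NuRingTheory.
Variable R : nuRingType.
Implicit Types a b v u w t : R.

Lemma numul0l a : 0 ** a = 0.
Proof. by apply: (addrI (0 ** a)); rewrite -numulDl !addr0. Qed.

Lemma numul0r a : a ** 0 = 0.
Proof. by apply: (addrI (a ** 0)); rewrite -numulDr !addr0. Qed.

Lemma numulNl a b : (- a) ** b = - (a ** b).
Proof. by apply: (addrI (a ** b)); rewrite -numulDl !subrr numul0l. Qed.

Lemma numulNr a b : a ** (- b) = - (a ** b).
Proof. by apply: (addrI (a ** b)); rewrite -numulDr !subrr numul0r. Qed.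

Lemma numulBl a b v : (a - b) ** v = a ** v - b ** v.
Proof. by rewrite numulDl numulNl. Qed.

Lemma numulBr a b v : v ** (a - b) = v ** a - v ** b.
Proof. by rewrite numulDr numulNr. Qed.

Lemma numul_suml I (r : seq I) (P : pred I) (F : I -> R) a :
  (\sum_(i <- r | P i) F i) ** a = \sum_(i <- r | P i) F i ** a.
Proof.
exact: (big_morph (fun x => x ** a) (fun x y => numulDl x y a) (numul0l a)).
Qed.

Lemma numul_sumr I (r : seq I) (P : pred I) (F : I -> R) a :
  a ** (\sum_(i <- r | P i) F i) = \sum_(i <- r | P i) a ** F i.
Proof. exact: (big_morph (numul a) (numulDr a) (numul0r a)). Qed.

(** Membership of [u] and [u'] in the corner of [v] is stated by equations, which can be added up
    over orthogonal idempotents. *)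
Definition local_inverses a v u u' :=
  [/\ v ** v = v, v ** a = a, a ** v = a & a ** u ** a = a] /\
  [/\ v ** u = u, u ** v = u, v ** u' = u' & u' ** v = u'] /\
  u ** u' = v /\ u' ** u = v.

Lemma local_inverses0 : local_inverses 0 0 0 0.
Proof. by rewrite /local_inverses !numul0l. Qed.

(** Orthogonality of [v] and [w] kills every mixed product, so all the equations hold summand by
    summand. *)
Lemma local_inversesD a v u u' b w t t' :
    v ** w = 0 -> w ** v = 0 ->
    local_inverses a v u u' -> local_inverses b w t t' ->
  local_inverses (a + b) (v + w) (u + t) (u' + t').
Proof.
move=> vw wv [[vv va av aua] [[vu uv vu' u'v] [uu' u'u]]].
move=> [[ww wb bw btb] [[wt tw wt' t'w] [tt' t't]]].
have ortho (x y : R) : x ** v = x -> w ** y = y -> x ** y = 0.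
  by move=> <- <-; rewrite numulA -(numulA x) vw numul0r numul0l.
have ortho' (x y : R) : x ** w = x -> v ** y = y -> x ** y = 0.
  by move=> <- <-; rewrite numulA -(numulA x) wv numul0r numul0l.
have sum (x y z s : R) : x ** v = x -> y ** w = y -> v ** z = z -> w ** s = s ->
    (x + y) ** (z + s) = x ** z + y ** s.
  move=> xv yw vz ws; rewrite numulDl !numulDr (ortho x s) // (ortho' y z) //.
  by rewrite addr0 add0r.
have auv : a ** u ** v = a ** u by rewrite -numulA uv.
have btw : b ** t ** w = b ** t by rewrite -numulA tw.
by split; [|split]; split; rewrite !sum // ?(vv, va, av, ww, wb, bw, vu, uv, vu',
  u'v, wt, tw, wt', t'w, uu', u'u, tt', t't, aua, btb).
Qed.

Lemma locally_unit_regularW :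
  (forall a, exists v u u', local_inverses a v u u') -> locally_unit_regular R.
Proof.
move=> H a; have [v [u [u' [[vv va av aua] [[vu uv vu' u'v] [uu' u'u]]]]]] := H a.
exists v, u, u'; split; split=> //.
  by exists u; rewrite // vu uv.
by exists u'; rewrite // vu' u'v.
Qed.

Lemma locally_unit_regular_unital (one : R) :
  locally_unit_regular R -> is_identity one -> unit_regular one.
Proof.
move=> lur one1 a; have [v [u [u' [[vv [x _ xu] [x' _ xu']]]]]] := lur a.
have l1 y : one ** y = y by case: (one1 y).
have r1 y : y ** one = y by case: (one1 y).
have vu : v ** u = u by rewrite -xu !numulA vv.
have uv : u ** v = u by rewrite -xu -!numulA vv.
have vu' : v ** u' = u' by rewrite -xu' !numulA vv.
have u'v : u' ** v = u' by rewrite -xu' -!numulA vv.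
move=> [uu' u'u va av aua].
pose w := one - v.
have ww : w ** w = w by rewrite {1}/w numulBl l1 numulBr r1 vv subrr subr0.
have vxw y : y ** v = y -> y ** w = 0 by rewrite numulBr r1 => ->; rewrite subrr.
have wvx y : v ** y = y -> w ** y = 0 by rewrite numulBl l1 => ->; rewrite subrr.
have vw1 : v + w = one by rewrite addrC subrK.
(* From here on [w] is an abstract idempotent complementary to [v]; the inverse of [u + w] is
   [u' + w]. *)
move: w ww vxw wvx vw1 => w ww vxw wvx vw1; exists (u + w).
  exists (u' + w); split; rewrite numulDl !numulDr ww !vxw // !wvx //;
    by rewrite add0r addr0 ?uu' ?u'u.
by rewrite numulDr (vxw a) // addr0.
Qed.

(** Idempotence puts [p] in [aR], and [e], in place of an identity, puts [a] in [pR]. With [p = ax]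
    and [a = py], one gets [axa = ppy = a]. *)
Lemma star_regular_inner_inverse (star : R -> R) a e :
  star_regular star -> a ** e = a -> exists x, a ** x ** a = a.
Proof.
move=> /(_ a) [p [_ pp] aRpR] ae.
have [x _ ax] : principal_right_ideal a p by rewrite aRpR; exists p.
have [y _ py] : principal_right_ideal p a by rewrite -aRpR; exists e.
by exists x; rewrite ax -py numulA -pp.
Qed.

End NuRingTheory.

(** * Local inverses for combinations of matrix units *)

Section MatrixUnits.
Variables (K : fieldType) (L : nuAlgType K) (T : eqType).
Variables (Q : seq T) (E : T -> T -> L).
Hypothesis Q_uniq : uniq Q.
Hypothesis E_mul : {in Q & Q, forall p q, {in Q & Q, forall r s,
  E p q ** E r s = if q == r then E p s else 0}}.

(** The map [phi] from square matrices to [L] is multiplicative and sends the identity to the sum of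
    the [E p p], so an invertible inner inverse of a matrix suffices. *)
Lemma matrix_units_local_inverses (A : T -> T -> K) :
  exists u u', local_inverses
    (\sum_(p <- Q) \sum_(q <- Q) A p q *: E p q) (\sum_(p <- Q) E p p) u u'.
Proof.
pose t := tnth (in_tuple Q).
have tQ i : t i \in Q by apply: mem_tnth.
have t_eq i j : (t i == t j) = (i == j).
  by apply/eqP/eqP=> [|-> //]; move/tuple_uniqP: (Q_uniq : uniq (in_tuple Q)); apply.
pose phi (M : 'M[K]_(size Q)) : L := \sum_i \sum_j M i j *: E (t i) (t j).
have phiM M N : phi M ** phi N = phi (M *m N).
  rewrite /phi numul_suml; apply: eq_bigr => i _.
  rewrite numul_suml.
  under eq_bigr => j _.
    rewrite numul_sumr (bigD1 j) //= [X in _ + X]big1 ?addr0; last first.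
      move=> k kj; rewrite numul_sumr big1 // => l _.
      rewrite -nuscaleAl -nuscaleAr E_mul //.
      by rewrite t_eq eq_sym (negbTE kj) !scaler0.
    rewrite numul_sumr.
    under eq_bigr => l _ do
      rewrite -nuscaleAl -nuscaleAr E_mul // eqxx scalerA.
    over.
  rewrite exchange_big /=; apply: eq_bigr => l _.
  by rewrite mxE scaler_suml.
have phi1 : \sum_(p <- Q) E p p = phi 1%:M.
  rewrite big_tnth; apply: eq_bigr => i _.
  rewrite (bigD1 i) //= big1 ?addr0; first by rewrite mxE eqxx scale1r.
  by move=> j ji; rewrite mxE eq_sym (negbTE ji) scale0r.
pose M := \matrix_(i, j) A (t i) (t j).
have phiA : \sum_(p <- Q) \sum_(q <- Q) A p q *: E p q = phi M.
  rewrite big_tnth; apply: eq_bigr => i _; rewrite big_tnth.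
  by apply: eq_bigr => j _; rewrite mxE.
(* In the rank factorization [M = C D R], with [C] and [R] invertible and [D] a diagonal idempotent,
   [R^-1 C^-1] is an inner inverse of [M] because [D D = D]; its inverse is [C R]. *)
exists (phi (invmx (row_ebase M) *m invmx (col_ebase M))).
exists (phi (col_ebase M *m row_ebase M)).
have Ru := row_ebase_unit M; have Cu := col_ebase_unit M.
rewrite phiA phi1; do !split; rewrite !phiM ?mul1mx ?mulmx1 //; congr phi.
- rewrite -{1 4}(mulmx_ebase M) !mulmxA mulmxK // mulmxKV //.
  rewrite -(mulmxA (col_ebase M) (pid_mx _) (pid_mx _)) mul_pid_mx.
  by rewrite minnn (minn_idPr (rank_leq_row M)) mulmx_ebase.
- by rewrite mulmxA mulmxKV // mulVmx.
- by rewrite mulmxA mulmxK // mulmxV.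
Qed.

End MatrixUnits.

(** * Matrix units of a finite set of edges *)

Section PathNotions.
Variable E : graph.

Fixpoint path_end (v : vertex E) (es : seq (edge E)) : vertex E :=
  if es is e :: es' then path_end (edge_range e) es' else v.

Lemma path_end_rcons v es e : path_end v (rcons es e) = edge_range e.
Proof. by elim: es v => //= f es IHes v. Qed.

Lemma is_path_from_rcons v es e :
  is_path_from v (rcons es e) <->
  is_path_from v es /\ edge_source e = path_end v es.
Proof.
elim: es v => /= [|f es IHes] v; first by split=> [] [].
by rewrite IHes; split=> [[-> [? ?]]|[[-> ?] ?]].
Qed.

Lemma is_path_from_cat v es fs :
  is_path_from v (es ++ fs) <->
  is_path_from v es /\ is_path_from (path_end v es) fs.
Proof.
elim: es v => /= [|f es IHes] v; first by split=> [|[]].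
by rewrite IHes; split=> [[-> [? ?]]|[[-> ?] ?]].
Qed.

Lemma is_path_from_nth v (es : seq (edge E)) e0 n :
  is_path_from v es -> (n.+1 < size es)%N ->
  edge_range (nth e0 es n) = edge_source (nth e0 es n.+1).
Proof.
elim: es v n => // e [|f es] IHes v [|n] [_ pes] //; first by case: pes.
exact: IHes pes.
Qed.

Lemma path_end_nth v e (es : seq (edge E)) e0 :
  path_end v (e :: es) = edge_range (nth e0 (e :: es) (size es)).
Proof. by elim: es v e => //= f es IHes v e; apply: IHes. Qed.

Definition acyclic :=
  forall v es, is_path_from v es -> path_end v es = v -> es = [::].

(** If an edge recurs, the segment from one occurrence up to just before a later one is a nonempty
    closed path. *)
Lemma acyclic_uniq (v : vertex E) (es : seq {classic edge E}) :
  acyclic -> is_path_from v es -> uniq es.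
Proof.
move=> acyc; elim: es v => //= e es IHes v [_ ev]; rewrite (IHes _ ev) andbT.
apply/negP => /path.splitPr esE; case: esE ev => es1 es2 ev.
have [|ev1 /= [se _]] := (is_path_from_cat (edge_range e) es1 (e :: es2)).1 _.
  exact: ev.
have := acyc (edge_source e) (e :: es1) (conj erefl ev1) (esym se).
by [].
Qed.

End PathNotions.

Section PathElements.
Variables (K : fieldType) (E : graph).
Local Notation L := (lpa K E).
Local Notation V := (@lpa_vertex K E).
Local Notation X := (@lpa_edge K E).
Local Notation G := (@lpa_ghost K E).
Local Notation lpaF := (@lpa_family K E).
Implicit Types (v w : vertex E) (es fs : seq (edge E)).

(** Unlike in [lpa_path], the recursion removes the first edge and the vertex kept as a factor is
    the last one; this suits the cancellation of first edges by (CK1). *)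
Fixpoint path_elt v es : L :=
  if es is e :: es' then X e ** path_elt (edge_range e) es' else V v.

Fixpoint ghost_elt v es : L :=
  if es is e :: es' then ghost_elt (edge_range e) es' ** G e else V v.

Lemma vertexM v : V v ** V v = V v. Proof. exact: leavitt_V lpaF _. Qed.

Lemma vertexMN v w : v <> w -> V v ** V w = 0.
Proof. exact: leavitt_V0 lpaF _ _. Qed.

Lemma path_vertex v es : path_elt v es ** V (path_end v es) = path_elt v es.
Proof. by elim: es v => /= [v|e es IHes v]; rewrite -?numulA ?IHes ?vertexM. Qed.

Lemma ghost_vertex v es :
  is_path_from v es -> ghost_elt v es ** V v = ghost_elt v es.
Proof.
case: es => /= [_|e es [<- _]]; first exact: vertexM.
by rewrite -numulA (leavitt_P2s lpaF).
Qed.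

Lemma path_elt_rcons v es e : is_path_from v (rcons es e) ->
  path_elt v (rcons es e) = path_elt v es ** X e.
Proof.
elim: es v => /= [v [<- _]|f es IHes v [_ /IHes->]]; last by rewrite numulA.
by rewrite (leavitt_P1r lpaF) (leavitt_P1s lpaF).
Qed.

Lemma ghost_elt_rcons v es e : is_path_from v (rcons es e) ->
  ghost_elt v (rcons es e) = G e ** ghost_elt v es.
Proof.
elim: es v => /= [v [<- _]|f es IHes v [_ /IHes->]]; last by rewrite numulA.
by rewrite (leavitt_P2r lpaF) (leavitt_P2s lpaF).
Qed.

(** * Matrix units attached to a finite set of edges *)

Section FiniteEdgeSet.
Variable F : seq {classic edge E}.
Hypothesis F_uniq : uniq F.

(** What is left of [v] after splitting off the edges in [F]. By (CK2) it is zero if [F] contains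
    all edges emitted by [v] and there is at least one. *)
Definition cut v : L :=
  V v - \sum_(f <- F | `[< edge_source f = v >]) X f ** G f.

Lemma vertex_cut v : V v ** cut v = cut v.
Proof.
rewrite /cut numulBr vertexM numul_sumr; congr (_ - _).
by apply: eq_bigr => f /asboolP <-; rewrite numulA (leavitt_P1s lpaF).
Qed.

Lemma cut_vertex v : cut v ** V v = cut v.
Proof.
rewrite /cut numulBl vertexM numul_suml; congr (_ - _).
by apply: eq_bigr => f /asboolP <-; rewrite -numulA (leavitt_P2s lpaF).
Qed.

(** If [v] emits [f], (CK1) leaves only the term of [f], which occurs once as [F] has no
    repetitions, and it cancels against [v f = f]. Otherwise every term vanishes. *)
Lemma cut_edge v f : f \in F -> cut v ** X f = 0.
Proof.
move=> fF; rewrite /cut numulBl numul_suml.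
have [sf|sf] := asboolP (edge_source f = v); last first.
  have -> : V v ** X f = 0.
    by rewrite -(leavitt_P1s lpaF) numulA vertexMN ?numul0l // => /esym.
  rewrite sub0r big1 ?oppr0 // => e /asboolP se.
  by rewrite -numulA (leavitt_CK10 lpaF) ?numul0r // => ef; apply: sf; rewrite -ef.
rewrite -big_filter (bigD1_seq f) ?filter_uniq //=; last first.
  by rewrite mem_filter fF andbT; apply/asboolP.
rewrite big1 => [|e /eqP ef]; last first.
  by rewrite -numulA (leavitt_CK10 lpaF) ?numul0r.
by rewrite -numulA (leavitt_CK1 lpaF) (leavitt_P1r lpaF) -sf
  (leavitt_P1s lpaF) addr0 subrr.
Qed.

Lemma ghost_cut v f : f \in F -> G f ** cut v = 0.
Proof.
move=> fF; rewrite /cut numulBr numul_sumr.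
have [sf|sf] := asboolP (edge_source f = v); last first.
  have -> : G f ** V v = 0.
    by rewrite -(leavitt_P2s lpaF) -numulA vertexMN ?numul0r.
  rewrite sub0r big1 ?oppr0 // => e /asboolP se.
  by rewrite numulA (leavitt_CK10 lpaF) ?numul0l // => ef; apply: sf; rewrite ef.
rewrite -big_filter (bigD1_seq f) ?filter_uniq //=; last first.
  by rewrite mem_filter fF andbT; apply/asboolP.
rewrite big1 => [|e /eqP ef]; last first.
  by rewrite numulA (leavitt_CK10 lpaF) ?numul0l // => /esym.
by rewrite numulA (leavitt_CK1 lpaF) (leavitt_P2r lpaF) -sf
  (leavitt_P2s lpaF) addr0 subrr.
Qed.

Lemma cutM v : cut v ** cut v = cut v.
Proof.
rewrite {2}/cut numulBr cut_vertex numul_sumr big1_seq ?subr0 // => f /andP[_ fF].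
by rewrite numulA cut_edge ?numul0l.
Qed.

Definition path_in v (es : seq {classic edge E}) :=
  is_path_from v es /\ {subset es <= F}.

Local Notation walk := ({classic vertex E} * seq {classic edge E})%type.
Local Notation wend p := (path_end p.1 p.2).

(** Equal first edges cancel by (CK1), and distinct ones give 0. If one path runs out first, the
    next edge of the other lies in [F] and is killed by the adjacent cut. *)
Lemma cut_ghost_path_cut (p q : walk) :
    path_in p.1 p.2 -> path_in q.1 q.2 ->
  cut (wend p) ** ghost_elt p.1 p.2 ** path_elt q.1 q.2 ** cut (wend q) =
  if p == q then cut (wend p) else 0.
Proof.
case: p q => [v es] [w fs] /=.
elim: es v w fs => [|e es IHes] v w [|f fs] /= [pv Fes] [pw Ffs].
- rewrite cut_vertex -numulA vertex_cut xpair_eqE eqxx andbT.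
  have [->|/eqP vw] := eqVneq v w; first exact: cutM.
  by rewrite -(cut_vertex v) -(vertex_cut w) -numulA (numulA (V v)) vertexMN //
    numul0l numul0r.
- rewrite cut_vertex numulA cut_edge ?numul0l; last by apply: Ffs; rewrite inE eqxx.
  by rewrite xpair_eqE andbF.
- rewrite -!numulA vertex_cut ghost_cut ?numul0r; last by apply: Fes; rewrite inE eqxx.
  by rewrite xpair_eqE andbF.
rewrite !numulA -(numulA _ (G e)) xpair_eqE eqseq_cons.
case: pv => <- pe; case: pw => <- pf.
have [ef|/eqP ef] := eqVneq e f; last first.
  by rewrite (leavitt_CK10 lpaF) // numul0r !numul0l andbF.
rewrite -ef in pf Ffs *; rewrite eqxx (leavitt_CK1 lpaF) -(numulA _ _ (V _)).
rewrite ghost_vertex //.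
rewrite IHes ?xpair_eqE ?eqxx //; split=> //.
  by move=> x xes; apply: Fes; rewrite inE xes orbT.
by move=> x xes; apply: Ffs; rewrite inE xes orbT.
Qed.

Definition path_unit (p q : walk) : L :=
  path_elt p.1 p.2 ** cut (wend p) ** ghost_elt q.1 q.2.

Lemma path_unitM (p q r s : walk) :
    path_in q.1 q.2 -> path_in r.1 r.2 -> wend p = wend q ->
  path_unit p q ** path_unit r s = if q == r then path_unit p s else 0.
Proof.
move=> qP rP pq; rewrite /path_unit.
transitivity (path_elt p.1 p.2 ** (cut (wend q) ** ghost_elt q.1 q.2 **
    path_elt r.1 r.2 ** cut (wend r)) ** ghost_elt s.1 s.2).
  by rewrite pq !numulA.
rewrite cut_ghost_path_cut //; case: eqP => _; last by rewrite numul0r numul0l.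
by rewrite pq.
Qed.

Variable W : seq {classic vertex E}.

Definition walk_in (p : walk) := p.1 \in W /\ path_in p.1 p.2.

Inductive unit_span : L -> Prop :=
  | unit_span0 : unit_span 0
  | unit_spanD x y : unit_span x -> unit_span y -> unit_span (x + y)
  | unit_spanZ k x : unit_span x -> unit_span (k *: x)
  | unit_span_unit p q : walk_in p -> walk_in q -> wend p = wend q ->
      unit_span (path_unit p q).

Lemma unit_spanM x y : unit_span x -> unit_span y -> unit_span (x ** y).
Proof.
elim=> [yS|x1 x2 _ IH1 _ IH2 yS|k x1 _ IH yS|p q pW qW pq].
- by rewrite numul0l; apply: unit_span0.
- by rewrite numulDl; apply: unit_spanD; auto.
- by rewrite -nuscaleAl; apply: unit_spanZ; auto.
elim=> [|y1 y2 _ IH1 _ IH2|k y1 _ IH|r s rW sW rs].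
- by rewrite numul0r; apply: unit_span0.
- by rewrite numulDr; apply: unit_spanD.
- by rewrite -nuscaleAr; apply: unit_spanZ.
rewrite path_unitM //; [|by case: qW|by case: rW].
case: eqP => [qr|_]; last exact: unit_span0.
by apply: unit_span_unit => //; rewrite pq qr.
Qed.

Hypothesis E_acyclic : acyclic E.

(** This bound both stops the expansion in [path_ghost_span] and makes the walks finite in
    number. *)
Lemma path_in_size v es : path_in v es -> (size es <= size F)%N.
Proof. by case=> /(acyclic_uniq E_acyclic) u s; apply: uniq_leq_size. Qed.

Lemma walk_in_rcons (p : walk) f :
    walk_in p -> f \in F -> edge_source f = wend p ->
  walk_in (p.1, rcons p.2 f).
Proof.
move=> [pW [pP pF]] fF sf; split=> //=; split.
  exact/is_path_from_rcons.
by move=> x; rewrite mem_rcons inE => /predU1P[-> //|/pF].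
Qed.

(* Substituting [w = cut w + \sum_f f f^*] in [p w q^*] lengthens [p] and [q],
   which acyclicity allows only finitely often. *)
Lemma path_ghost_span (p q : walk) : walk_in p -> walk_in q -> wend p = wend q ->
  unit_span (path_elt p.1 p.2 ** ghost_elt q.1 q.2).
Proof.
have [n] := ubnP (size F - size p.2)%N; elim: n p q => // n IHn p q + pW qW pq.
move=> pn; rewrite -(path_vertex p.1) -numulA (_ : V (wend p) =
    cut (wend p) + \sum_(f <- F | `[< edge_source f = wend p >]) X f ** G f).
  rewrite numulDl numulDr numulA; apply: unit_spanD; first exact: unit_span_unit.
  rewrite numul_suml numul_sumr.
  rewrite big_seq_cond; elim/big_rec: _ => [|f x /andP[fF /asboolP sf] xS].
    exact: unit_span0.
  apply: unit_spanD => //.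
  have pfW := walk_in_rcons pW fF sf.
  have qfW : walk_in (q.1, rcons q.2 f) by apply: walk_in_rcons; rewrite // sf.
  rewrite -numulA numulA -path_elt_rcons; last by case: pfW => _ [].
  rewrite -ghost_elt_rcons; last by case: qfW => _ [].
  apply: (IHn (p.1, rcons p.2 f) (q.1, rcons q.2 f)) => //=; last first.
    by rewrite !path_end_rcons.
  (* The longer walk still obeys the bound, so [size p.2 < size F] and the truncated subtraction
     really decreases. *)
  have := path_in_size pfW.2; rewrite /= size_rcons => lt.
  by rewrite subnS prednK ?subn_gt0 // -ltnS.
by rewrite subrK.
Qed.

End FiniteEdgeSet.

(** The claim covers all larger [W] and [F], so that two elements can be treated together over the
    union of their data. *)
Lemma unit_span_generated (a : L) : acyclic E ->
  exists (W0 : seq {classic vertex E}) (F0 : seq {classic edge E}),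
    forall W F, {subset W0 <= W} -> {subset F0 <= F} -> uniq F -> unit_span F W a.
Proof.
move=> acyc; elim/lpa_generators_ind: a.
- move=> v; exists [:: v : {classic vertex E}], [::] => W F sW sF Fu.
  have vW : walk_in F W (v, [::]) by split=> //; apply: sW; rewrite inE eqxx.
  by have := path_ghost_span acyc vW vW erefl; rewrite /= vertexM.
(* The edge is [e r(e)^*], so the trivial walk at its range must also start in [W]. *)
- move=> e; pose W0 : seq {classic vertex E} := [:: edge_source e; edge_range e].
  exists W0, [:: e : {classic edge E}] => W F sW sF Fu.
  have vW : walk_in F W (edge_range e, [::]).
    by split=> //; apply: sW; rewrite !inE eqxx orbT.
  have eW : walk_in F W (edge_source e, [:: e : {classic edge E}]).
    by split; [apply: sW; rewrite inE eqxx|split].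
  have := path_ghost_span acyc eW vW erefl.
  by rewrite /= -numulA vertexM (leavitt_P1r lpaF).
- move=> e; pose W0 : seq {classic vertex E} := [:: edge_source e; edge_range e].
  exists W0, [:: e : {classic edge E}] => W F sW sF Fu.
  have vW : walk_in F W (edge_range e, [::]).
    by split=> //; apply: sW; rewrite !inE eqxx orbT.
  have eW : walk_in F W (edge_source e, [:: e : {classic edge E}]).
    by split; [apply: sW; rewrite inE eqxx|split].
  have := path_ghost_span acyc vW eW erefl.
  by rewrite /= numulA vertexM (leavitt_P2r lpaF).
- by exists [::], [::] => W F _ _ _; apply: unit_span0.
- move=> x y [W1 [F1 S1]] [W2 [F2 S2]]; exists (W1 ++ W2), (F1 ++ F2).
  move=> W F sW sF Fu; apply: unit_spanD; [apply: S1|apply: S2] => // z zs;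
  by [apply: sW; rewrite mem_cat zs ?orbT|apply: sF; rewrite mem_cat zs ?orbT].
- move=> k x [W1 [F1 S1]]; exists W1, F1 => W F sW sF Fu.
  by apply: unit_spanZ; apply: S1.
- move=> x y [W1 [F1 S1]] [W2 [F2 S2]]; exists (W1 ++ W2), (F1 ++ F2).
  move=> W F sW sF Fu; apply: unit_spanM => //; [apply: S1|apply: S2] => // z zs;
  by [apply: sW; rewrite mem_cat zs ?orbT|apply: sF; rewrite mem_cat zs ?orbT].
Qed.

End PathElements.

(** * Acyclic graphs: block decomposition and local inverses *)

Section AcyclicLocallyUnitRegular.
Variables (K : fieldType) (E : graph).
Hypothesis E_acyclic : acyclic E.
Local Notation L := (lpa K E).
Local Notation walk := ({classic vertex E} * seq {classic edge E})%type.
Local Notation wend p := (path_end p.1 p.2 : {classic vertex E}).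

Lemma words_enumeration (T : eqType) (F : seq T) n :
  exists ws : seq (seq T),
    forall es, (size es <= n)%N -> {subset es <= F} -> es \in ws.
Proof.
elim: n => [|n [ws wsP]]; first by exists [:: [::]] => -[|].
exists ([::] :: [seq f :: es | f <- F, es <- ws]) => -[|f es] // sz sF.
rewrite inE /=; apply/allpairsP; exists (f, es); split=> //=.
  by apply: sF; rewrite inE eqxx.
by apply: wsP => // x xes; apply: sF; rewrite inE xes orbT.
Qed.

Lemma walks_enumeration (F : seq {classic edge E}) (W : seq {classic vertex E}) :
  exists2 Q : seq walk, uniq Q & forall p, p \in Q <-> walk_in F W p.
Proof.
have [ws wsP] := words_enumeration F (size F).
exists (undup [seq p <- [seq (v, es) | v <- W, es <- ws] | `[< walk_in F W p >]]).
  exact: undup_uniq.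
move=> p; rewrite mem_undup mem_filter; split=> [/andP[/asboolP]//|pW].
apply/andP; split; first exact/asboolP.
case: p pW => v es [/= vW pF]; apply/allpairsP; exists (v, es); split=> //=.
by apply: wsP; [apply: path_in_size pF | case: pF].
Qed.

(** In a unit [p w' q^*] both walks end at the same vertex; grouping by that vertex gives one full
    matrix block for each. *)
Lemma unit_span_coef F W (Q : seq walk) (a : L) :
    uniq Q -> (forall p, p \in Q <-> walk_in F W p) -> unit_span F W a ->
  exists A : walk -> walk -> K,
    a = \sum_(w <- undup [seq wend p | p <- Q])
          \sum_(p <- [seq p : walk <- Q | wend p == w])
            \sum_(q <- [seq q : walk <- Q | wend q == w]) A p q *: path_unit K F p q.
Proof.
move=> Qu QP; elim=> [|x y _ [A ->] _ [B ->]|k x _ [A ->]|p q pW qW pq].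
- exists (fun _ _ => 0); rewrite big1 // => w _; rewrite big1 // => p _.
  by rewrite big1 // => q _; rewrite scale0r.
- exists (fun p q => A p q + B p q); rewrite -big_split; apply: eq_bigr => w _.
  rewrite -big_split; apply: eq_bigr => p _; rewrite -big_split.
  by apply: eq_bigr => q _; rewrite scalerDl.
- exists (fun p q => k * A p q); rewrite scaler_sumr; apply: eq_bigr => w _.
  rewrite scaler_sumr; apply: eq_bigr => p _; rewrite scaler_sumr.
  by apply: eq_bigr => q _; rewrite scalerA.
have pQ := (QP p).2 pW; have qQ := (QP q).2 qW.
(* The matrix whose only nonzero entry is a 1 at [(p, q)]. *)
exists (fun r s => ((r == p) && (s == q))%:R).
rewrite (bigD1_seq (wend p)) ?undup_uniq ?mem_undup /=; last 2 first.
- exact: (map_f (fun p : walk => wend p) pQ).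
- by [].

rewrite (bigD1_seq p) ?filter_uniq ?mem_filter ?eqxx //=.
rewrite (bigD1_seq q) ?filter_uniq ?mem_filter ?pq ?eqxx //=.
rewrite scale1r big1 => [|s /negbTE->]; last by rewrite scale0r.
rewrite big1 => [|r /negbTE->]; last by rewrite big1 // => s _; rewrite scale0r.
rewrite big1 ?addr0 // => w wp; apply: big1_seq => r.
rewrite mem_filter => /andP[_ /andP[/eqP rw _]]; rewrite big1 // => s _.
by case: eqP => [rp|_]; rewrite ?scale0r //; rewrite -rw rp pq eqxx in wp.
Qed.

Lemma acyclic_local_inverses (a : L) : exists v u u', local_inverses a v u u'.
Proof.
have [W [F0 aS]] := unit_span_generated a E_acyclic.
have {F0}[F Fu {}aS] : exists2 F, uniq F & unit_span F W a.
  exists (undup F0); first exact: undup_uniq.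
  by apply: aS; rewrite ?undup_uniq // => f; rewrite mem_undup.
have [Q Qu QP] := walks_enumeration F W.
have {aS}[A ->] := unit_span_coef Qu QP aS.
set ws := undup _; pose Qw w := [seq p : walk <- Q | wend p == w].
have QwP w p : p \in Qw w -> path_in F p.1 p.2 /\ wend p = w.
  by rewrite mem_filter => /andP[/eqP <- /QP[]].
pose id w := \sum_(p <- Qw w) path_unit K F p p.
have id_ortho w w' : w != w' -> id w ** id w' = 0.
  move=> ww'; rewrite numul_suml big_seq big1 // => p /QwP[pF pw].
  rewrite numul_sumr big_seq big1 // => q /QwP[qF qw].
  rewrite path_unitM //; case: eqP => // pq.
  by rewrite -pw -qw pq eqxx in ww'.
(* The idempotent is fixed before the induction, since the next block must be known to be orthogonal
   to it; only [u] and [u'] come from the induction hypothesis. *)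
exists (\sum_(w <- ws) id w).
elim: ws (undup_uniq _ : uniq ws) => [_|w ws IHws /= /andP[wws /IHws[u [u' IH]]]].
  by exists 0, 0; rewrite !big_nil; apply: local_inverses0.
have [t [t' tP]] : exists t t', local_inverses
    (\sum_(p <- Qw w) \sum_(q <- Qw w) A p q *: path_unit K F p q) (id w) t t'.
  apply: matrix_units_local_inverses; first exact: filter_uniq.
  move=> p q /QwP[_ pw] /QwP[qF qw] r s /QwP[rF _] _.
  by apply: path_unitM; rewrite // pw.
exists (t + u), (t' + u'); rewrite !big_cons; apply: local_inversesD => //.
  rewrite numul_sumr big_seq big1 // => w' w's; apply: id_ortho.
  by apply: contraNneq wws => ->.
rewrite numul_suml big_seq big1 // => w' w's; apply: id_ortho.
by apply: contraNneq wws => <-.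
Qed.

End AcyclicLocallyUnitRegular.

(** * Closed paths *)

Section InfinitePathRepresentation.
Variables (K : fieldType) (E : graph).
Implicit Types (q : nat -> edge E) (i : int) (v : vertex E) (e : edge E).

Definition infinite_path q := forall n, edge_range (q n) = edge_source (q n.+1).

(** The module [M] consists of functions on all edge sequences; requiring a path here makes every
    generator act as 0 off the infinite paths. *)
Definition starts_at v q := `[< infinite_path q /\ edge_source (q 0%N) = v >].
Definition starts_with e q := `[< infinite_path q /\ q 0%N = e >].

Definition tail_path q : nat -> edge E := fun n => q n.+1.
Definition cons_path e q : nat -> edge E := fun n => if n is m.+1 then q m else e.

Lemma cons_tail_path q : cons_path (q 0%N) (tail_path q) = q.
Proof. by apply/funext => -[]. Qed.

Lemma infinite_path_cons e q :
  infinite_path (cons_path e q) <-> starts_at (edge_range e) q.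
Proof.
split=> [eq|/asboolP[pq sq] [|n] //=].
by apply/asboolP; split=> [n|]; [apply: (eq n.+1)|rewrite (eq 0%N)].
Qed.

Lemma starts_at_tail q : infinite_path q ->
  starts_at (edge_range (q 0%N)) (tail_path q).
Proof. by move=> pq; apply/infinite_path_cons; rewrite cons_tail_path. Qed.

Lemma starts_with_cons e f q :
  starts_with f (cons_path e q) = starts_at (edge_range e) q && `[< e = f >].
Proof.
apply/asboolP/andP=> [[/infinite_path_cons ? ?]|[? /asboolP?]].
  by split=> //; apply/asboolP.
by split=> //; apply/infinite_path_cons.
Qed.

Local Notation M := ((nat -> edge E) -> int -> K).

(* Without the [int] coordinate, which edges raise and ghost edges lower, the
   module would not be graded and [v - c] would kill [c^oo]. *)
Fixpoint act (x : lexpr K E) (phi : M) : M := fun q i =>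
  match x with
  | LVertex v => if starts_at v q then phi q i else 0
  | LEdge e => if starts_with e q then phi (tail_path q) (i - 1) else 0
  | LGhost e =>
      if starts_at (edge_range e) q then phi (cons_path e q) (i + 1) else 0
  | LZero => 0
  | LAdd x y => act x phi q i + act y phi q i
  | LScale k x => k * act x phi q i
  | LMul x y => act x (act y phi) q i
  end.

Lemma funext2 (phi psi : M) : phi =2 psi -> phi = psi.
Proof. by move=> e; apply/funext => q; apply/funext. Qed.

Lemma act_linear x k phi psi :
  act x (fun q i => k * phi q i + psi q i) =
  fun q i => k * act x phi q i + act x psi q i.
Proof.
elim: x phi psi => [v|e|e||x IHx y IHy|l x IHx|x IHx y IHy] phi psi;
  apply: funext2 => q i /=; try by case: ifP; rewrite ?mulr0 ?addr0.
- by rewrite mulr0 addr0.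
- by rewrite IHx IHy mulrDr addrACA.
- by rewrite IHx mulrDr mulrCA.
- by rewrite IHy IHx.
Qed.

Lemma actD x phi psi :
  act x (fun q i => phi q i + psi q i) = fun q i => act x phi q i + act x psi q i.
Proof.
have <- : (fun q i => 1 * phi q i + psi q i) = fun q i => phi q i + psi q i.
  by apply: funext2 => q i; rewrite mul1r.
by rewrite act_linear; apply: funext2 => q i; rewrite mul1r.
Qed.

Lemma act0 x : act x (fun _ _ => 0) = fun _ _ => 0.
Proof.
apply: funext2 => q i; apply: (addrI (act x (fun _ _ => 0) q i)).
rewrite addr0 -[RHS]/((fun q i => _) q i).
have := actD x (fun _ _ => 0) (fun _ _ => 0).
move/(congr1 (fun phi => phi q i)) => /= <-; congr (act x _ q i).
by apply: funext2 => ? ?; rewrite addr0.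
Qed.

Lemma actZ x k phi : act x (fun q i => k * phi q i) = fun q i => k * act x phi q i.
Proof.
have <- : (fun q i => k * phi q i + 0) = fun q i => k * phi q i.
  by apply: funext2 => q i; rewrite addr0.
rewrite (act_linear x k phi (fun _ _ => 0)) act0.
by apply: funext2 => q i; rewrite addr0.
Qed.

(** Generators change the degree by a constant. This is what moves [1 - T] past [x] in
    [closed_path_not_regular]. *)
Lemma act_shift x (m : int) phi :
  act x (fun q i => phi q (i - m)) = fun q i => act x phi q (i - m).
Proof.
elim: x phi => [v|e|e||x IHx y IHy|l x IHx|x IHx y IHy] phi;
  apply: funext2 => q i //=.
- by rewrite addrAC.
- by rewrite addrAC.
- by rewrite IHx IHy.
- by rewrite IHx.
- by rewrite IHy IHx.
Qed.

Definition bounded_by (B : nat) (phi : M) :=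
  forall q i, (B < `|i|)%N -> phi q i = 0.

(** An edge or ghost edge moves the degree by one, so [N] depends on the expression alone. *)
Lemma act_bounded x :
  exists N, forall B phi, bounded_by B phi -> bounded_by (B + N) (act x phi).
Proof.
elim: x => [v|e|e||x [N IHx] y [N' IHy]|l x [N IHx]|x [N IHx] y [N' IHy]].
- by exists 0%N => B phi H q i lt /=; rewrite H ?if_same //; lia.
- by exists 1%N => B phi H q i lt /=; rewrite H ?if_same //; lia.
- by exists 1%N => B phi H q i lt /=; rewrite H ?if_same //; lia.
- by exists 0%N.
- exists (N + N')%N => B phi H q i lt /=.
  by rewrite (IHx B) ?(IHy B) ?addr0 //; lia.
- by exists N => B phi H q i lt /=; rewrite (IHx B) ?mulr0.
- exists (N' + N)%N => B phi H q i lt /=.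
  by apply: (IHx (B + N')%N); [apply: IHy|rewrite -addnA].
Qed.

Lemma act_sum (s : seq (lexpr K E)) phi q i :
  act (lexpr_sum s) phi q i = \sum_(x <- s) act x phi q i.
Proof. by elim: s => [|x s IHs] /=; rewrite ?big_nil // big_cons IHs. Qed.

Lemma starts_with_source e q : starts_with e q -> starts_at (edge_source e) q.
Proof. by move=> /asboolP[pq qe]; apply/asboolP; rewrite qe. Qed.

Lemma starts_with_tail e q : starts_with e q ->
  starts_at (edge_range e) (tail_path q).
Proof. by move=> /asboolP[pq <-]; apply: starts_at_tail. Qed.

Lemma starts_at_inj v w q : starts_at v q -> starts_at w q -> v = w.
Proof. by move=> /asboolP[_ <-] /asboolP[_ <-]. Qed.

Lemma act_edge_ghost e phi q i :
  act (LMul (LEdge K e) (LGhost K e)) phi q i =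
  if starts_with e q then phi q i else 0.
Proof.
rewrite /=; case: ifP => // qe; rewrite (starts_with_tail qe) subrK.
by case/asboolP: qe => _ <-; rewrite cons_tail_path.
Qed.

Lemma act_lequiv (x y : lexpr K E) : lequiv x y -> act x = act y.
Proof.
move=> xy; apply/funext => phi; apply: funext2.
elim: xy phi => {x y}.
- by [].
- by move=> x y _ IH phi q i; rewrite IH.
- by move=> y x z _ IH1 _ IH2 phi q i; rewrite IH1 IH2.
- by move=> x x' y y' _ IH1 _ IH2 phi q i /=; rewrite IH1 IH2.
- by move=> k x x' _ IH phi q i /=; rewrite IH.
- by move=> x x' y y' _ IH1 _ IH2 phi q i /=; rewrite IH1 (funext2 (IH2 phi)).
- by move=> x y z phi q i /=; rewrite addrA.
- by move=> x y phi q i /=; rewrite addrC.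
- by move=> x phi q i /=; rewrite add0r.
- by move=> x phi q i /=; rewrite mulN1r addNr.
- by move=> k l x phi q i /=; rewrite mulrA.
- by move=> x phi q i /=; rewrite mul1r.
- by move=> k x y phi q i /=; rewrite mulrDr.
- by move=> k l x phi q i /=; rewrite mulrDl.
- by [].
- by [].
- by move=> x y z phi q i /=; rewrite actD.
- by [].
- by move=> k x y phi q i /=; rewrite actZ.
- by move=> v phi q i /=; case: (starts_at _ q).
- move=> v w vw phi q i /=; case: ifP => // qv; case: ifP => // qw.
  by case: vw; apply: starts_at_inj qv qw.
- by move=> e phi q i /=; case: ifPn => // /negP qs; case: ifP => // /starts_with_source.
- move=> e phi q i /=; case: ifP => // /asboolP[pq <-].
  by rewrite starts_at_tail.
- by move=> e phi q i /=; case: (starts_at _ q).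
- move=> e phi q i /=; case: ifP => // qe; rewrite ifT //.
  by apply/asboolP; split=> //; apply/infinite_path_cons.
- move=> e phi q i /=; case: ifP => // qe; rewrite starts_with_cons qe addrK.
  by rewrite ifT //; apply/asboolP.
- move=> e f ef phi q i /=; case: ifP => // qe.
  by rewrite starts_with_cons; case: asboolP => // _; rewrite andbF.
(* (CK2): [e e^*] restricts to the paths beginning with [e], and an infinite path from [v] begins
   with exactly one edge of [es]. *)
move=> v es sv iv [esu esP] phi q i; rewrite act_sum big_map [LHS]/=.
under eq_bigr => e _ do rewrite act_edge_ghost.
rewrite -big_mkcond /= -big_filter.
case: ifPn => [/asboolP[pq qv]|/negP qv]; last first.
  rewrite (@big_seq _ _ _ {classic edge E}) big1 // => e.
  rewrite mem_filter => /andP[qe /esP ev].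
  by case: qv; rewrite -ev; apply: starts_with_source.
suff /(perm_small_eq (isT : (size [:: _] <= 1)%N))-> :
    perm_eq [seq e : {classic edge E} <- es | starts_with e q]
      [:: q 0%N : {classic edge E}] by rewrite big_seq1.
apply: uniq_perm => [||e]; rewrite ?filter_uniq // mem_filter inE.
apply/andP/eqP => [[/asboolP[]]//|->].
by split; [apply/asboolP|apply/esP].
Qed.

Definition lact (x : lpa K E) : M -> M := act (repr x).

Lemma lact_lpi x : lact (lpi x) = act x.
Proof. exact/act_lequiv/lequiv_repr. Qed.

Lemma lactM x y phi : lact (x ** y) phi = lact x (lact y phi).
Proof.
elim/lpa_ind: x => x; elim/lpa_ind: y => y.
by rewrite -lpi_mul !lact_lpi.
Qed.

Lemma lactB x y phi q i : lact (x - y) phi q i = lact x phi q i - lact y phi q i.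
Proof.
elim/lpa_ind: x => x; elim/lpa_ind: y => y.
by rewrite -scaleN1r -lpi_scale -lpi_add !lact_lpi /= mulN1r.
Qed.

Definition cat_path es q : nat -> edge E := foldr cons_path q es.

Lemma cat_path_nth e0 es q n : (n < size es)%N -> cat_path es q n = nth e0 es n.
Proof. by elim: es n => [|f es IHes] [|n] //= /IHes. Qed.

Lemma cat_path_drop es q n : cat_path es q (size es + n)%N = q n.
Proof. by elim: es => [|f es IHes]. Qed.

Lemma lact_path v es phi q i :
    is_path_from v es -> starts_at (path_end v es) q ->
  lact (path_elt K v es) phi (cat_path es q) i = phi q (i - (size es)%:Z).
Proof.
elim: es v i => /= [|e es IHes] v i.
  by move=> _ qv; rewrite lact_lpi /= qv subr0.
move=> [_ pes] qe; rewrite lactM lact_lpi /= starts_with_cons.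
case: asboolP => // _; rewrite andbT ifT.
  rewrite -[tail_path _]/(cat_path es q) IHes //.
  by congr (phi q _); lia.
elim: es {IHes} (edge_range e) pes qe => //= f es IHes w [<- pes] qe.
apply/asboolP; split=> //; apply/infinite_path_cons; exact: IHes.
Qed.

(** The hypothesis concerns the sequences left after stripping [es] from [q]; it is vacuous if [q]
    does not begin with [es]. *)
Lemma lact_path0 v es phi q i :
    (forall q', q = cat_path es q' -> phi q' (i - (size es)%:Z) = 0) ->
  lact (path_elt K v es) phi q i = 0.
Proof.
elim: es v q i => /= [|e es IHes] v q i phi0.
  by rewrite lact_lpi /=; have := phi0 q erefl; rewrite subr0 => ->; rewrite if_same.
rewrite lactM lact_lpi /=; case: ifP => // /asboolP[_ qe].
apply: IHes => q' qq'; rewrite -(phi0 q'); first by congr (phi q' _); lia.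
by rewrite -qq' -qe cons_tail_path.
Qed.

End InfinitePathRepresentation.

(** Repeated downward steps of length [m] leave the range where [h] can be nonzero. *)
Lemma eventually_zero_periodic (K : zmodType) (h : int -> K) (m B : nat) (i : int) :
    (0 < m)%N -> (forall j, j <= i -> h (j - m%:Z) = h j) ->
    (forall j, (B < `|j|)%N -> h j = 0) ->
  h i = 0.
Proof.
move=> m0 hm hB; have hk k : h (i - (k * m)%N%:Z) = h i.
  elim: k => [|k IHk]; first by rewrite subr0.
  rewrite -IHk -[RHS]hm; last by lia.
  by congr h; rewrite mulSn; lia.
(* That many steps, each of length at least 1, lead from [i] to below [-B]. *)
rewrite -(hk (`|i| + B).+1); apply: hB.
by have := leq_pmulr (`|i| + B).+1 m0; lia.
Qed.

(** * A closed path obstructs von Neumann regularity *)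

Section ClosedPaths.
Variables (K : fieldType) (E : graph) (v : vertex E) (e : edge E) (es : seq (edge E)).
Let c := e :: es.
Hypotheses (c_path : is_path_from v c) (c_closed : path_end v c = v).

Let c_oo n := nth e c (n %% size c).

Lemma c_oo_infinite : infinite_path c_oo.
Proof.
move=> n; rewrite /c_oo modnS; have lt := ltn_pmod n (isT : (0 < size c)%N).
case: ifPn => [dvd|ndvd].
  (* The period wraps around: the last edge of [c] is followed by the first, which is where
     closedness enters. *)
  have -> : (n %% size c)%N = (size c).-1.
    move: dvd; rewrite {1}(divn_eq n (size c)) -addnS dvdn_addr ?dvdn_mull //.
    by move/dvdn_leq => /(_ isT); lia.
  transitivity (path_end v c); first exact/esym/path_end_nth.
  by rewrite c_closed; case: c_path.
apply: is_path_from_nth c_path _; rewrite ltn_neqAle lt andbT.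
apply: contra ndvd => /eqP nE.
by rewrite {1}(divn_eq n (size c)) -addnS nE dvdn_add // dvdn_mull.
Qed.

Lemma c_oo_cat : cat_path c c_oo = c_oo.
Proof.
apply/funext => n; have [lt|le] := ltnP n (size c).
  by rewrite (cat_path_nth e) // /c_oo modn_small.
by rewrite -(subnKC le) cat_path_drop /c_oo modnDl.
Qed.

Lemma c_oo_starts : starts_at v c_oo.
Proof. by apply/asboolP; split; [apply: c_oo_infinite|case: c_path]. Qed.

Let a : lpa K E := lpa_vertex K v - path_elt K v c.
Let m := size c.

(** As [c c^oo = c^oo], stripping [c] changes only the degree. *)
Lemma act_oo phi i : lact a phi c_oo i = phi c_oo i - phi c_oo (i - m%:Z).
Proof.
rewrite lactB lact_lpi [act _ _ _ _]/= c_oo_starts; congr (_ - _).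
rewrite -{1}c_oo_cat lact_path // c_closed.
exact: c_oo_starts.
Qed.

Let f (q : nat -> edge E) (i : int) : K := (`[< q = c_oo >] && (i == 0))%:R.

(** Off [c^oo] both sides vanish: [f] lives on [c^oo] alone, and a sequence that becomes [c^oo] when
    [c] is stripped is [c^oo] itself. *)
Lemma act_delta : lact a f = fun q i => f q i - f q (i - m%:Z).
Proof.
apply: funext2 => q i; have [->|qc] := pselect (q = c_oo); first exact: act_oo.
have f0 j : f q j = 0 by rewrite /f; case: asboolP.
rewrite !f0 lactB lact_path0 ?subr0 => [|q' qq'].
  by rewrite lact_lpi [act _ _ _ _]/= f0 if_same.
by rewrite /f; case: asboolP => // q'c; case: qc; rewrite qq' q'c c_oo_cat.
Qed.

Lemma closed_path_not_regular x : a ** x ** a <> a.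
Proof.
move=> axa; have m0 : (0 < m)%N by [].
pose y := lact x f.
have zE : lact x (lact a f) = fun q i => y q i - y q (i - m%:Z).
  rewrite act_delta; have -> : (fun q i => f q i - f q (i - m%:Z)) =
      fun q i => (-1) * f q (i - m%:Z) + f q i.
    by apply: funext2 => q i; rewrite mulN1r addrC.
  rewrite /lact act_linear act_shift.
  by apply: funext2 => q i; rewrite mulN1r addrC.
have [N yN] : exists N, bounded_by N y.
  have [N xN] := act_bounded (repr x); exists (0 + N)%N; apply: xN => q i.
  by rewrite /f; case: eqP => [->|]; rewrite ?andbF.
(* Since [x a f = (1 - T) y], the equation [a x a f = a f] makes [(1 - T) y - f] periodic along
   [c^oo]; being bounded, it is zero there. *)
have yf i : y c_oo i - y c_oo (i - m%:Z) = f c_oo i.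
  apply/eqP; rewrite -subr_eq0; apply/eqP.
  pose h j := y c_oo j - y c_oo (j - m%:Z) - f c_oo j.
  apply: (@eventually_zero_periodic _ h m (N + m)) => //.
    move=> j _; have := act_oo (lact x (lact a f)) j.
    have -> : lact a (lact x (lact a f)) = lact a f by rewrite -!lactM axa.
    rewrite zE act_delta /h.
    by move=> /eqP; rewrite subr_eq => /eqP ->; ring.
  move=> j lt; rewrite /h !yN; try by lia.
  by rewrite /f (_ : (j == 0) = false) ?andbF ?subrr //; lia.
have fE i : f c_oo i = (i == 0)%:R by rewrite /f; case: asboolP.
(* The delta function vanishes in negative degrees, so [y] repeats with period [m] from [-m]
   downwards. *)
have y_neg : y c_oo (- m%:Z) = 0.
  apply: (@eventually_zero_periodic _ (y c_oo) m N) => // [j le|j]; last exact: yN.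
  apply/eqP; rewrite eq_sym -subr_eq0 yf fE.
  by have -> : (j == 0) = false by lia.
(* Reflecting the degree turns the upward argument along [0, m, 2m, ...] into a downward one. Then
   [y] at 0 minus [y] at [-m] cannot be 1. *)
have y0 : y c_oo 0 = 0.
  rewrite -oppr0.
  apply: (@eventually_zero_periodic _ (fun j => y c_oo (- j)) m N) => // [j le|j lt].
    rewrite opprB addrC; apply/eqP; rewrite -subr_eq0.
    have -> : - j = (- j + m%:Z) - m%:Z by rewrite addrK.
    rewrite subrK yf fE.
    by have -> : (- j + m%:Z == 0) = false by lia.
  by apply: yN; lia.
by have := yf 0; rewrite fE eqxx add0r y_neg y0 subr0 => /eqP;
  rewrite eq_sym oner_eq0.
Qed.

End ClosedPaths.

(** For a closed path [c] at [v], the relation [c v = c] lets [v] stand in for an identity in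
    finding an inner inverse of [v - c]. *)
Lemma star_regular_acyclic (K : fieldType) (E : graph) (star : lpa K E -> lpa K E) :
  star_regular star -> acyclic E.
Proof.
move=> sr v [|e es] // pc cc.
pose a := lpa_vertex K v - path_elt K v (e :: es).
have ae : a ** lpa_vertex K v = a.
  rewrite numulBl vertexM; congr (_ - _).
  by have := path_vertex K v (e :: es); rewrite cc.
have [x axa] := star_regular_inner_inverse sr ae.
by case: (closed_path_not_regular pc cc axa).
Qed.

Theorem corollary4p2 (E : graph) (K : fieldType) (conj : K -> K)
    (conjP : is_involution *%R conj)
    (star_reg : star_regular (@lpa_star K E conj)) :
  locally_unit_regular (lpa K E) /\
  (forall one : lpa K E, is_identity one -> unit_regular one).
Proof.
have lur : locally_unit_regular (lpa K E).
  exact/locally_unit_regularW/acyclic_local_inverses/star_regular_acyclic/star_reg.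
by split=> // one; apply: locally_unit_regular_unital.
Qed.
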